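(* Let $\beta \geq 2$ be a fixed integer. For the minimum problem under uncertainty (even when the family consists of a single set), for the sorting problem under uncertainty, and for the MST problem under uncertainty, there is no deterministic $\beta$-robust algorithm that is $\alpha$-consistent for any $\alpha < 1 + \frac{1}{\beta}$. Conversely, for any $\alpha>1$, no deterministic $\alpha$-consistent algorithm is $\beta$-robust for any $\beta < \max\{\frac{1}{\alpha-1},2\}$.
   Context: Uncertainty intervals: each uncertain element $i$ has an interval $I_i$ that is either open, $I_i=(L_i,U_i)$, or trivial, $I_i=\{w_i\}$; it has an unknown true value $w_i\in I_i$ and a given predicted value $\bar w_i\in I_i$. A query of $I_i$ reveals $w_i$. Minimum problem: given intervals $\mathcal{I}=\{I_1,\dots,I_n\}$ and a family $\mathcal{S}$ of subsets of $\mathcal{I}$, determine for each $S\in\mathcal{S}$ an element of $S$ with minimum true value. Sorting problem: same input; determine for each $S\in\mathcal{S}$ the order of its elements by true value. MST problem: given a graph $G=(V,E)$ with an uncertainty interval (and prediction) for each edge weight, determine a spanning tree that is a minimum spanning tree for the true weights. A query set $Q$ is feasible if, knowing the true values of the elements in $Q$ (and the intervals of the others), the required answer is the same for every assignment of values in the intervals that agrees with the true values on $Q$. $\mathrm{opt}$ denotes the minimum size of a feasible query set for the true values. An algorithm knows the intervals and predictions (not the true values), queries elements adaptively one by one, and stops when its queries form a feasible set; $|\mathrm{ALG}|$ is its number of queries. It is $\rho$-competitive if $|\mathrm{ALG}|\le\rho\cdot\mathrm{opt}$ on every instance; $\alpha$-consistent if it is $\alpha$-competitive on all instances whose predictions are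 all correct ($\bar w_i=w_i$ for all $i$); $\beta$-robust if it is $\beta$-competitive on all instances regardless of the predictions. *)

(* Defs.v *)
From HB Require Import structures.
From mathcomp Require Import all_boot all_order all_algebra.
From mathcomp Require Import boolp reals.
Set Implicit Arguments.
Unset Strict Implicit.
Unset Printing Implicit Defensive.
Import Order.TTheory GRing.Theory Num.Theory.
Local Open Scope ring_scope.

Inductive uinterval (R : realType) : Type :=
| OpenItv of R & R
| TrivialItv of R.

Definition in_uinterval (R : realType) (I : uinterval R) (x : R) : Prop :=
  match I with
  | OpenItv L U => L < x < U
  | TrivialItv v => x = v
  end.

(* [nelems x] is the number of uncertain elements of the input [x], which are
   indexed by ['I_(nelems x)]; the intervals and predictions are kept apart from
   the combinatorial part [x] of the input.  [correct x w a] says that [a] is an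
   acceptable answer when the values of the elements are [w]; several answers
   may be acceptable for the same [w]. *)
Record problem (R : realType) : Type := Problem {
  input : Type;
  admissible : input -> Prop;
  nelems : input -> nat;
  answer : input -> Type;
  correct : forall x : input, ('I_(nelems x) -> R) -> answer x -> Prop
}.

Section Queries.
Variables (R : realType) (P : problem R).

(* Deterministic adaptive algorithm: from the input, the intervals, the
   predictions and the (element, revealed value) pairs seen so far, it chooses
   the next element to query, or stops ([None]). *)
Definition algorithm : Type := forall x : input P,
  ('I_(nelems x) -> uinterval R) -> ('I_(nelems x) -> R) ->
  seq ('I_(nelems x) * R) -> option 'I_(nelems x).

Section Instance.
Variable x : input P.
Variables (itv : 'I_(nelems x) -> uinterval R) (wbar w : 'I_(nelems x) -> R).

Definition valid_instance : Prop :=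
  [/\ admissible x, forall i, in_uinterval (itv i) (wbar i)
    & forall i, in_uinterval (itv i) (w i)].

Definition feasible (Q : {set 'I_(nelems x)}) : Prop :=
  exists a : answer x, forall w' : 'I_(nelems x) -> R,
    (forall i, in_uinterval (itv i) (w' i)) ->
    (forall i, i \in Q -> w' i = w i) ->
    correct w' a.

(* The default [setT] of the minimum is irrelevant: querying every element of a
   valid instance is feasible for the problems below. *)
Definition opt : nat :=
  #|[arg min_(Q < [set: 'I_(nelems x)] | `[< feasible Q >]) #|Q| ]|.

Fixpoint history (A : algorithm) (k : nat) : seq ('I_(nelems x) * R) :=
  if k is k'.+1 then
    let h := history A k' in
    if A x itv wbar h is Some i then rcons h (i, w i) else h
  else [::].

Definition queried (h : seq ('I_(nelems x) * R)) : {set 'I_(nelems x)} :=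
  [set i in [seq q.1 | q <- h]].

(* An algorithm that never stops, or stops with an infeasible set, is not
   competitive for any ratio. *)
Definition competitive_on (rho : R) (A : algorithm) : Prop :=
  exists k : nat,
    [/\ A x itv wbar (history A k) = None,
        feasible (queried (history A k))
      & (size (history A k))%:R <= rho * opt%:R].

End Instance.

Definition consistent (alpha : R) (A : algorithm) : Prop :=
  forall (x : input P) (itv : 'I_(nelems x) -> uinterval R)
         (wbar w : 'I_(nelems x) -> R),
    valid_instance itv wbar w -> (forall i, wbar i = w i) ->
    competitive_on itv wbar w alpha A.

Definition robust (beta : R) (A : algorithm) : Prop :=
  forall (x : input P) (itv : 'I_(nelems x) -> uinterval R)
         (wbar w : 'I_(nelems x) -> R),
    valid_instance itv wbar w -> competitive_on itv wbar w beta A.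

End Queries.

Record set_system : Type := SetSystem {
  ground : nat;
  family : {set {set 'I_ground}}
}.

Definition nonempty_sets (x : set_system) : Prop := set0 \notin family x.

Section MinSort.
Variable R : realType.

Definition min_answer (x : set_system) : Type :=
  {S : {set 'I_(ground x)} | S \in family x} -> 'I_(ground x).

Definition min_correct (x : set_system) (w : 'I_(ground x) -> R)
    (a : min_answer x) : Prop :=
  forall S, a S \in val S /\ (forall j, j \in val S -> w (a S) <= w j).

Definition minimum_problem : problem R :=
  @Problem R set_system nonempty_sets ground min_answer min_correct.

Definition single_set_minimum_problem : problem R :=
  @Problem R set_system (fun x => nonempty_sets x /\ #|family x| = 1%N)
    ground min_answer min_correct.

Definition sort_answer (x : set_system) : Type :=
  {set 'I_(ground x)} -> seq 'I_(ground x).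

Definition sort_correct (x : set_system) (w : 'I_(ground x) -> R)
    (a : sort_answer x) : Prop :=
  forall S, S \in family x ->
    perm_eq (a S) (enum S) /\ sorted (fun i j => w i <= w j) (a S).

Definition sorting_problem : problem R :=
  @Problem R set_system nonempty_sets ground sort_answer sort_correct.

End MinSort.

Record graph : Type := Graph {
  nverts : nat;
  nedges : nat;
  ends : 'I_nedges -> {set 'I_nverts}
}.

Section MST.
Variable G : graph.

Definition adj (T : {set 'I_(nedges G)}) : rel 'I_(nverts G) :=
  fun u v => [exists e in T, ends e == [set u; v]].

Definition spanning_connected (T : {set 'I_(nedges G)}) : Prop :=
  forall u v, connect (adj T) u v.

(* In a simple graph, the closed walks of length 2 allowed by [ucycle] traverse
   a single edge back and forth, hence the bound 3. *)
Definition acyclic (T : {set 'I_(nedges G)}) : Prop :=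
  forall c : seq 'I_(nverts G), ucycle (adj T) c -> (size c < 3)%N.

Definition spanning_tree (T : {set 'I_(nedges G)}) : Prop :=
  spanning_connected T /\ acyclic T.

Definition simple_connected : Prop :=
  [/\ injective (@ends G), forall e : 'I_(nedges G), #|ends e| = 2%N
    & spanning_connected [set: 'I_(nedges G)]].

Definition min_spanning_tree (R : realType) (w : 'I_(nedges G) -> R)
    (T : {set 'I_(nedges G)}) : Prop :=
  spanning_tree T /\
  forall T', spanning_tree T' -> \sum_(e in T) w e <= \sum_(e in T') w e.

End MST.

Definition mst_problem (R : realType) : problem R :=
  @Problem R graph simple_connected nedges (fun G => {set 'I_(nedges G)})
    (fun G w T => min_spanning_tree w T).

(* Main.v *)
Require Import Defs.
From mathcomp Require Import all_boot all_order all_algebra.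
From mathcomp Require Import boolp reals.
From mathcomp Require Import zify lra.
Set Implicit Arguments.
Unset Strict Implicit.
Unset Printing Implicit Defensive.
Import Order.TTheory GRing.Theory Num.Theory.
Local Open Scope ring_scope.

(* All four problems contain the following star instance: a center with interval
   (0, 4) and b leaves with interval (1, 5), where solving the instance amounts
   to deciding whether the center is at most every leaf. The center alone is
   feasible if its value is 1, and the leaves alone are feasible if their values
   are 4. Predict the value 2 for the center and 4 for the leaves. If this is
   correct then opt = b and every feasible set contains the leaves, so a ratio
   below 1 + 1/b forces the algorithm to query exactly the leaves. If instead
   the leaf queried last has value 3 and the center has value 1, the algorithm
   makes the same b queries and still needs the center, whereas opt = 1: its
   robustness is at least b + 1. With a single leaf, an adversary that puts the
   first queried value into the other interval forces two queries while
   opt = 1. For spanning trees the values are negated and the elements are the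
   edges of a cycle, of which a minimum spanning tree omits a heaviest one. *)

(** * Runs of an algorithm and the sets they query *)

Section Runs.
Variables (R : realType) (P : problem R) (x : input P).
Variables (itv : 'I_(nelems x) -> uinterval R) (wbar : 'I_(nelems x) -> R).
Implicit Types (w : 'I_(nelems x) -> R) (A : algorithm P).

Lemma feasible_subset w (Q Q' : {set 'I_(nelems x)}) :
  Q \subset Q' -> feasible itv w Q -> feasible itv w Q'.
Proof.
move=> /subsetP sQ [a Ha]; exists a => w' Iw' w'E.
by apply: Ha => // i iQ; apply/w'E/sQ.
Qed.

Lemma opt_le_card w (Q : {set 'I_(nelems x)}) :
  feasible itv w Q -> (opt itv w <= #|Q|)%N.
Proof.
move=> fQ; rewrite /opt; case: arg_minnP => [|Q' _ minQ'].
  by apply/asboolP/(feasible_subset (subsetT Q)).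
by apply/minQ'/asboolP.
Qed.

Lemma card_queried (h : seq ('I_(nelems x) * R)) :
  (#|queried h| <= size h)%N.
Proof. by rewrite cardsE -(size_map fst); apply: card_size. Qed.

Lemma queried_rcons (h : seq ('I_(nelems x) * R)) p :
  queried (rcons h p) = p.1 |: queried h.
Proof. by apply/setP => i; rewrite !inE map_rcons mem_rcons inE. Qed.

Lemma queried_historyS w A k :
  queried (history itv wbar w A k) \subset queried (history itv wbar w A k.+1).
Proof.
by rewrite /=; case: (A _ _ _ _) => [i|] //; rewrite queried_rcons subsetUr.
Qed.

Lemma queried_history_mono w A k l : (k <= l)%N ->
  queried (history itv wbar w A k) \subset queried (history itv wbar w A l).
Proof.
elim: l => [|l IHl]; first by rewrite leqn0 => /eqP ->.
rewrite leq_eqVlt => /predU1P[-> // | /IHl]; move/subset_trans; apply.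
exact: queried_historyS.
Qed.

Lemma history_stop w A k l :
  A x itv wbar (history itv wbar w A k) = None -> (k <= l)%N ->
  history itv wbar w A l = history itv wbar w A k.
Proof.
move=> stop; elim: l => [|l IHl]; first by rewrite leqn0 => /eqP ->.
by rewrite leq_eqVlt => /predU1P[<- // | /IHl /= ->]; rewrite stop.
Qed.

Lemma queried_stop w A k l :
  A x itv wbar (history itv wbar w A k) = None ->
  queried (history itv wbar w A l) \subset queried (history itv wbar w A k).
Proof.
move=> stop; case: (leqP l k) => [|/ltnW]; first exact: queried_history_mono.
by move/(history_stop stop) => ->.
Qed.

(** A deterministic algorithm sees values only through its queries, so an adversary may change the
    others without altering the run. *)
Lemma eq_history w w' A k :
  (forall i, i \in queried (history itv wbar w A k) -> w' i = w i) ->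
  history itv wbar w' A k = history itv wbar w A k.
Proof.
elim: k => //= k IHk eqw.
have -> : history itv wbar w' A k = history itv wbar w A k.
  by apply: IHk => i iQ; apply/eqw/(subsetP (queried_historyS w A k)).
case: (A _ _ _ _) eqw => [j|] // /(_ j) -> //.
by rewrite queried_rcons setU11.
Qed.

(** A stopped run repeats its history, so [k] may exceed the number of queries; hence the separate
    index [l]. *)
Lemma history_rcons w A k h p :
  history itv wbar w A k = rcons h p ->
  exists2 l, history itv wbar w A l = h & A x itv wbar h = Some p.1.
Proof.
elim: k => [|k IHk] /=; first by case: h.
case E: (A _ _ _ _) => [j|] // /rcons_inj [hE pE]; exists k => //.
by rewrite -hE E -pE.
Qed.

End Runs.

(** * Sign reflection and the star instance *)

Definition signed (R : realType) (s : bool) (v : R) : R := if s then - v else v.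

Lemma signedK (R : realType) (s : bool) : involutive (@signed R s).
Proof. by case: s => v //=; rewrite opprK. Qed.

(** Negation swaps the endpoints. With [s = true] a heaviest edge becomes a minimum of the signed
    values, so one analysis covers all problems. *)
Definition signed_itv (R : realType) (s : bool) (L U : R) : uinterval R :=
  if s then OpenItv (- U) (- L) else OpenItv L U.

Lemma in_signed_itv (R : realType) (s : bool) (L U v : R) :
  in_uinterval (signed_itv s L U) v <-> L < signed s v < U.
Proof. by case: s => //=; split=> /andP[? ?]; apply/andP; split; lra. Qed.

Section Star.
Variables (R : realType) (n : nat) (s : bool) (z : 'I_n) (K : {set 'I_n}).

Definition star_itv (i : 'I_n) : uinterval R :=
  if i == z then signed_itv s 0 4
  else if i \in K then signed_itv s 1 5 else TrivialItv (signed s 5).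

(* [c] and [l i] tell whether the value of the center, resp. of the leaf [i],
   avoids the other interval. *)
Definition star_val (c : bool) (l : 'I_n -> bool) (i : 'I_n) : R :=
  signed s (if i == z then (if c then 1 else 2)
            else if i \in K then (if l i then 4 else 3) else 5).

Definition center_le (w : 'I_n -> R) : Prop :=
  forall i, i \in K -> signed s (w z) <= signed s (w i).

Definition center_lt (w : 'I_n -> R) : Prop :=
  forall i, i \in K -> signed s (w z) < signed s (w i).

Definition in_star (w : 'I_n -> R) : Prop :=
  forall i, in_uinterval (star_itv i) (w i).

Lemma in_starP (w : 'I_n -> R) : z \notin K ->
  in_star w <->
  [/\ 0 < signed s (w z) < 4, forall i, i \in K -> 1 < signed s (w i) < 5
    & forall i, i != z -> i \notin K -> signed s (w i) = 5].
Proof.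
move=> zK; rewrite /in_star /star_itv; split=> [Iw | [Iz IK Io] i].
  split=> [|i iK|i iz iK].
  - by move: (Iw z); rewrite eqxx => /in_signed_itv.
  - move: (Iw i); rewrite iK.
    by case: eqP iK zK => [-> -> //|_ _ _ /in_signed_itv].
  by move: (Iw i); rewrite (negPf iz) (negPf iK) /= => ->; rewrite signedK.
case: eqP => [->|/eqP iz]; first exact/in_signed_itv.
by case: ifPn => iK; [apply/in_signed_itv/IK | rewrite /= -(Io i) // signedK].
Qed.

End Star.

(* Both conditions together say that solving [x] on this instance amounts to
   deciding whether the center is at most all the leaves. *)
Definition star_input (R : realType) (P : problem R) (x : input P) (s : bool)
    (z : 'I_(nelems x)) (K : {set 'I_(nelems x)}) : Prop :=
  (exists a : answer x, forall w : 'I_(nelems x) -> R,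
     in_star s z K w -> center_le s z K w -> correct w a) /\
  (forall (a : answer x) (w1 w2 : 'I_(nelems x) -> R),
     in_star s z K w1 -> in_star s z K w2 -> correct w1 a -> correct w2 a ->
     center_lt s z K w1 -> center_le s z K w2).

Definition has_star (R : realType) (P : problem R) (b : nat) : Prop :=
  exists (x : input P) (s : bool) (z : 'I_(nelems x)) (K : {set 'I_(nelems x)}),
    [/\ admissible x, z \notin K, #|K| = b & star_input s z K].

(** * Feasible sets of the star instance, and the adversaries *)

Section StarQueries.
Variables (R : realType) (P : problem R) (x : input P) (s : bool).
Variables (z : 'I_(nelems x)) (K : {set 'I_(nelems x)}).
Hypotheses (admx : admissible x) (zK : z \notin K) (starx : star_input s z K).

Let itv := star_itv R s z K.
Let val c l : 'I_(nelems x) -> R := star_val R s z K c l.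
Let wbar := val false xpredT.

Lemma in_star_val c l : in_star s z K (val c l).
Proof.
apply/in_starP => //; rewrite /val /star_val; split=> [|i iK|i iz iK].
- by rewrite eqxx signedK; case: c; apply/andP; split; lra.
- rewrite signedK; case: eqP iK zK => [-> -> //|_ -> _].
  by case: (l i); apply/andP; split; lra.
by rewrite (negPf iz) (negPf iK) signedK.
Qed.

Lemma val_center c l : signed s (val c l z) = if c then 1 else 2.
Proof. by rewrite /val /star_val eqxx signedK. Qed.

Lemma val_leaf c l i : i \in K -> signed s (val c l i) = if l i then 4 else 3.
Proof.
by rewrite /val /star_val signedK => iK; case: eqP iK zK => [-> -> //|_ -> _].
Qed.

(** The center value 1 is the lower end of every leaf interval. *)
Lemma feasible_center l : feasible itv (val true l) [set z].
Proof.
have [[a Ha] _] := starx; exists a => w Iw wE; apply: Ha => // i iK.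
have [_ /(_ i iK) /andP[Ii _] _] := (in_starP s w zK).1 Iw.
by rewrite wE ?set11 // val_center ltW.
Qed.

(** The leaf value 4 is the upper end of the center interval. *)
Lemma feasible_leaves c : feasible itv (val c xpredT) K.
Proof.
have [[a Ha] _] := starx; exists a => w Iw wE; apply: Ha => // i iK.
have [/andP[_ Iz] _ _] := (in_starP s w zK).1 Iw.
by rewrite (wE i) // val_leaf // ltW.
Qed.

Lemma in_star_update w j v : in_star s z K w ->
  in_uinterval (itv j) v ->
  in_star s z K (fun i => if i == j then v else w i).
Proof. by move=> Iw Iv i; case: eqP => [->|_]. Qed.

(** The center value 2 lies inside every leaf interval, so an unqueried leaf could still fall below
    it, for instance to [3 / 2]. *)
Lemma feasible_leaves_queried l (Q : {set 'I_(nelems x)}) :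
  feasible itv (val false l) Q -> K \subset Q.
Proof.
have [_ dec] := starx; case=> a Ha; apply/subsetP => i iK.
apply: contraT => iQ.
have iz : i != z by apply: contraNneq zK => <-.
pose w2 j := if j == i then signed s (3 / 2) else val false l j.
have Iw2 : in_star s z K w2.
  apply: in_star_update; first exact: in_star_val.
  rewrite /itv /star_itv (negPf iz) iK; apply/in_signed_itv.
  by rewrite signedK; apply/andP; split; lra.
have /(_ i iK) : center_le s z K w2.
  apply: (dec a (val false l)) => //; first exact: in_star_val.
  - by apply: Ha => //; apply: in_star_val.
  - by apply: Ha => // j jQ; rewrite /w2; case: eqP iQ jQ => [-> /negPf ->|].
  by move=> j jK; rewrite val_center val_leaf //; case: (l j); lra.
by rewrite /w2 eqxx eq_sym (negPf iz) val_center signedK; lra.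
Qed.

(** The leaf value 3 lies inside the center interval, so an unqueried center could be on either side
    of it. *)
Lemma feasible_center_queried c l (Q : {set 'I_(nelems x)}) i :
  feasible itv (val c l) Q -> i \in K -> ~~ l i -> z \in Q.
Proof.
have [_ dec] := starx; case=> a Ha iK li; apply: contraT => zQ.
have iz : i != z by apply: contraNneq zK => <-.
pose w v j := if j == z then signed s v else val c l j.
have Iw v : 0 < v < 4 -> in_star s z K (w v).
  move=> Iv; apply: in_star_update; first exact: in_star_val.
  by rewrite /itv /star_itv eqxx; apply/in_signed_itv; rewrite signedK.
have Cw v : 0 < v < 4 -> correct (w v) a.
  move=> Iv; apply: Ha; first exact: Iw.
  by move=> j jQ; rewrite /w; case: eqP zQ jQ => [-> /negPf ->|].
(* [1 / 2] is below every leaf, while [7 / 2] exceeds the value 3 of leaf [i]. *)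
have I1 : 0 < (1 / 2 : R) < 4 by apply/andP; split; lra.
have I2 : 0 < (7 / 2 : R) < 4 by apply/andP; split; lra.
have /(_ i iK) : center_le s z K (w (7 / 2)).
  apply: (dec a (w (1 / 2))); [exact: Iw|exact: Iw|exact: Cw|exact: Cw|].
  move=> j jK; rewrite /w eqxx signedK; have -> : j == z = false.
    by apply/negbTE; apply: contraNneq zK => <-.
  by rewrite val_leaf //; case: (l j); lra.
by rewrite /w eqxx (negPf iz) signedK val_leaf // (negPf li); lra.
Qed.

Lemma star_valid c l : valid_instance itv wbar (val c l).
Proof. by split=> // i; apply: in_star_val. Qed.

(** Replacing [opt] by the larger [#|Q|] is monotone for a nonnegative ratio, hence
    [Num.max 0 rho]. *)
Lemma competitive_card w rho A (Q : {set 'I_(nelems x)}) :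
  feasible itv w Q -> competitive_on itv wbar w rho A ->
  exists k, [/\ A x itv wbar (history itv wbar w A k) = None,
    feasible itv w (queried (history itv wbar w A k)) &
    (size (history itv wbar w A k))%:R <= Num.max 0 rho * #|Q|%:R].
Proof.
move=> fQ [k [stop fk sz]]; exists k; split=> //; apply: le_trans sz _.
apply: (@le_trans _ _ (Num.max 0 rho * (opt itv w)%:R)).
  by rewrite ler_wpM2r ?ler0n // le_max lexx orbT.
by rewrite ler_wpM2l ?le_max ?lexx // ler_nat opt_le_card.
Qed.

Lemma max0_ge (m : nat) (rho : R) : (0 < m)%N ->
  m%:R <= Num.max 0 rho -> m%:R <= rho.
Proof.
move=> m0; rewrite le_max => /orP[|//].
by rewrite lern0 => /eqP m0'; rewrite m0' in m0.
Qed.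

Lemma robust_star_ge2 (beta : R) (A : algorithm P) : #|K| = 1%N -> robust beta A -> 2 <= beta.
Proof.
move=> K1 robA; have /card_gt0P[i iK] : (0 < #|K|)%N by rewrite K1.
(* The first query is chosen before any value is seen. If it is the leaf, the truth has leaf 3 and
   center 1; otherwise it is the prediction. Either way a single different element is feasible and
   must still be queried. *)
pose w := if A x itv wbar [::] is Some j then
  if j \in K then val true xpred0 else wbar else wbar.
have [k [stop fk sz]] : exists k, [/\ A x itv wbar (history itv wbar w A k) = None,
    feasible itv w (queried (history itv wbar w A k)) &
    (size (history itv wbar w A k))%:R <= Num.max 0 beta].
  have [Q Q1 fQ] : exists2 Q : {set 'I_(nelems x)}, #|Q| = 1%N & feasible itv w Q.
    have fw : feasible itv wbar K by exact: feasible_leaves.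
    rewrite /w; case: (A _ _ _ _) => [j|]; last by exists K.
    case: ifP => jK; last by exists K.
    by exists [set z]; [rewrite cards1|exact: feasible_center].
  have vw : valid_instance itv wbar w.
    rewrite /w; case: (A _ _ _ _) => [j|]; last exact: star_valid.
    by case: ifP => _; exact: star_valid.
  have [k [? ? sz]] := competitive_card fQ (robA _ _ _ _ vw).
  by exists k; split=> //; rewrite Q1 mulr1 in sz.
apply: (@max0_ge 2) => //; apply: le_trans sz; rewrite ler_nat.
apply: leq_trans (card_queried _).
have := queried_stop 1 stop; move: fk; rewrite /w /=.
(* An algorithm that stops at once leaves the leaf unqueried, which is infeasible. *)
case E: (A _ _ _ _) => [j|]; last first.
  move=> /feasible_leaves_queried /subset_trans KQ _.
  have stop0 : A x itv wbar (history itv wbar wbar A 0) = None by [].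
  have := KQ _ (queried_stop k stop0).
  by move/subsetP/(_ i iK); rewrite inE.
have qj v : j \in queried [:: (j, v)] by rewrite !inE eqxx.
case: ifP => jK fk /subsetP /(_ j (qj _)) jQ.
  have zQ := feasible_center_queried fk iK isT.
  have zj : z != j by apply: contraNneq zK => ->.
  rewrite -(_ : #|[set z; j]| = 2%N); last by rewrite cards2 zj.
  by apply/subset_leq_card; rewrite subUset !sub1set zQ jQ.
have /subsetP/(_ i iK) iQ := feasible_leaves_queried fk.
have ij : i != j by apply: contraTneq iK => ->; rewrite jK.
rewrite -(_ : #|[set i; j]| = 2%N); last by rewrite cards2 ij.
by apply/subset_leq_card; rewrite subUset !sub1set iQ jQ.
Qed.

(* If the predictions are right, the algorithm can afford the leaves only; the
   adversary then falsifies the prediction of the leaf queried last. *)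
Lemma consistent_robust_star (alpha beta : R) (A : algorithm P) : (0 < #|K|)%N ->
  alpha * #|K|%:R < #|K|.+1%:R -> consistent alpha A -> robust beta A ->
  #|K|.+1%:R <= beta.
Proof.
move=> K0 ltaK conA robA.
have [k [stop fk sz]] :=
  competitive_card (feasible_leaves false)
    (conA _ _ _ _ (star_valid false xpredT) (fun=> erefl)).
have szK : (size (history itv wbar wbar A k) <= #|K|)%N.
  rewrite -ltnS -(ltr_nat R); apply: le_lt_trans sz _.
  by rewrite maxEle; case: ifP => // _; rewrite mul0r ltr0n.
have KQ := feasible_leaves_queried fk.
(* At most [#|K|] queries cover all of [K], so nothing else is queried and nothing twice. *)
have QK : K = queried (history itv wbar wbar A k).
  apply/eqP; rewrite eqEcard KQ /=.
  exact: leq_trans (card_queried _) szK.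
case/lastP E: (history itv wbar wbar A k) => [|h p].
  by move: K0; rewrite QK E lt0n cards_eq0 => /eqP[]; apply/setP => i; rewrite !inE.
have [m hE hA] := history_rcons E.
move: QK szK; rewrite E queried_rcons size_rcons => QK szK.
have pK : p.1 \in K by rewrite QK setU11.
have ph : p.1 \notin queried h.
  apply/negP => ph; have := card_queried h.
  by rewrite leqNgt => /negP[]; apply: leq_trans szK _; rewrite QK (setUidPr _) ?sub1set.
(* [w] differs from the prediction only at the center and at [p.1], neither of which occurs in [h],
   so the run repeats up to [h]. *)
pose w := val true (fun j => j != p.1).
have hE' : history itv wbar w A m = h.
  rewrite -hE; apply: eq_history => j; rewrite hE => jh.
  have jK : j \in K by rewrite QK inE jh orbT.
  have jp : j != p.1 by apply: contraTneq jh => ->.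
  apply: (can_inj (@signedK R s)).
  by rewrite /w /wbar !val_leaf // jp.
have [k' [stop' fk' sz']] :=
  competitive_card (feasible_center (fun j => j != p.1)) (robA _ _ _ _ (star_valid _ _)).
rewrite -/w in stop' fk' sz'.
rewrite cards1 mulr1 in sz'.
apply: max0_ge => //; apply: le_trans sz'; rewrite ler_nat.
apply: leq_trans (card_queried _).
have zQ : z \in queried (history itv wbar w A k').
  by apply: (feasible_center_queried fk' pK); rewrite eqxx.
(* The repeated run has queried all of [K] by stage [m.+1]; the final set contains the center as
   well. *)
have := queried_stop m.+1 stop'; rewrite /= hE' hA queried_rcons /= -QK => KQ'.
rewrite -[#|K|.+1]add1n -(_ : #|z |: K| = 1 + #|K|)%N; last by rewrite cardsU1 zK.
by apply: subset_leq_card; rewrite subUset sub1set zQ.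
Qed.

End StarQueries.

(** * Consistency against robustness, given stars of every positive size *)

Section NoAlgorithm.
Variables (R : realType) (P : problem R).
Hypothesis starP : forall b, (0 < b)%N -> has_star P b.

Lemma robust_ge2 (beta : R) (A : algorithm P) : robust beta A -> 2 <= beta.
Proof.
have [x [s [z [K [admx zK K1 starx]]]]] := starP (ltn0Sn 0).
exact: (robust_star_ge2 admx zK starx K1).
Qed.

Lemma consistent_robust_ge (b : nat) (alpha beta : R) (A : algorithm P) :
  (0 < b)%N -> alpha * b%:R < b.+1%:R ->
  consistent alpha A -> robust beta A -> b.+1%:R <= beta.
Proof.
move=> b0; have [x [s [z [K [admx zK Kb starx]]]]] := starP b0.
rewrite -Kb => /(consistent_robust_star admx zK starx); apply.
by rewrite Kb.
Qed.

(** The bound on [alpha] says [alpha * b < b + 1], so a star with [b] leaves would force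
    [b + 1 <= b]. *)
Lemma robust_not_consistent (b : nat) (alpha : R) (A : algorithm P) :
  (0 < b)%N -> alpha < 1 + 1 / b%:R -> robust b%:R A -> ~ consistent alpha A.
Proof.
move=> b0 lta robA conA.
have bR : 0 < b%:R :> R by rewrite ltr0n.
have : b.+1%:R <= b%:R :> R.
  apply: (consistent_robust_ge b0 _ conA robA).
  by rewrite -ltr_pdivlMr // -natr1 mulrDl divff ?gt_eqF.
by rewrite ler_nat ltnn.
Qed.

(** For the least natural [m] with [1 / (alpha - 1) <= m], a star with [m - 1] leaves satisfies
    [alpha * (m - 1) < m] and forces robustness at least [m]. *)
Lemma consistent_robust_ge_inv (alpha beta : R) (A : algorithm P) :
  1 < alpha -> consistent alpha A -> robust beta A -> 1 / (alpha - 1) <= beta.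
Proof.
move=> alpha1 conA robA.
have a0 : 0 < alpha - 1 by rewrite subr_gt0.
have y0 : 0 < 1 / (alpha - 1) by rewrite divr_gt0.
have exm : exists m : nat, 1 / (alpha - 1) <= m%:R.
  by exists (Num.bound (1 / (alpha - 1))); rewrite ltW // archi_boundP // ltW.
case: (ex_minnP exm) => -[|b] ylem minm.
  by move: (lt_le_trans y0 ylem); rewrite ltxx.
(* [m = 1] would give a star without leaves; the general lower bound 2 covers this case. *)
apply: le_trans ylem _; case: b minm => [|b] minm.
  by apply: le_trans (robust_ge2 robA); rewrite ler_nat.
apply: (consistent_robust_ge (ltn0Sn b) _ conA robA).
have : b.+1%:R < 1 / (alpha - 1).
  by rewrite ltNge; apply/negP => /minm; rewrite ltnn.
by rewrite ltr_pdivlMr // -[b.+2%:R]natr1; lra.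
Qed.

End NoAlgorithm.

(** * A star on the elements of ['I_b.+2] *)

Section StarLeaves.
Variables (R : realType) (b : nat).

(* The last element has a trivial interval; it only serves to give the cycle of
   the spanning tree instance at least three edges. *)
Definition leaves : {set 'I_b.+2} := ~: [set ord0; ord_max].

Lemma center_notin_leaves : ord0 \notin leaves.
Proof. by rewrite !inE. Qed.

Lemma card_leaves : #|leaves| = b.
Proof.
have := cardsC [set ord0; ord_max : 'I_b.+2]; rewrite card_ord cards2.
by rewrite -/leaves => /eqP; rewrite /= add2n !eqSS => /eqP.
Qed.

(** The trivial element has signed value 5, above the center bound 4, so only the leaves compete
    with the center. *)
Lemma center_min s (w : 'I_b.+2 -> R) : in_star s ord0 leaves w ->
  center_le s ord0 leaves w -> forall i, signed s (w ord0) <= signed s (w i).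
Proof.
move=> /(in_starP _ _ center_notin_leaves)[/andP[_ Iz] _ Io] wle i.
have [->|iz] := eqVneq i ord0; first exact: lexx.
have [/wle //|iK] := boolP (i \in leaves).
by rewrite (Io i) //; lra.
Qed.

Lemma center_strict_min s (w : 'I_b.+2 -> R) : in_star s ord0 leaves w ->
  center_lt s ord0 leaves w ->
  forall i, signed s (w i) <= signed s (w ord0) -> i = ord0.
Proof.
move=> /(in_starP _ _ center_notin_leaves)[/andP[_ Iz] _ Io] wlt i wi.
apply: contraTeq wi => iz; rewrite -ltNge.
have [/wlt //|iK] := boolP (i \in leaves).
by rewrite (Io i) //; lra.
Qed.

End StarLeaves.

(** * Stars in the minimum and sorting problems *)

Section MinSortStar.
Variables (R : realType) (b : nat).

Definition full_system : set_system := @SetSystem b.+2 [set setT].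

Lemma full_system_nonempty : nonempty_sets full_system.
Proof.
by rewrite /nonempty_sets inE eq_sym -cards_eq0 cardsT card_ord.
Qed.

(** Admissibility is left arbitrary so that one proof serves both minimum problems. *)
Lemma min_star (adm : set_system -> Prop) :
  @star_input R (@Problem R set_system adm ground min_answer (@min_correct R))
    full_system false ord0 (leaves b).
Proof.
have inT : [set: 'I_b.+2] \in Defs.family full_system by rewrite inE.
pose S0 := exist (fun S => S \in Defs.family full_system) setT inT.
split.
  exists (fun=> ord0) => w Iw wle [S SF] /=; move: (SF); rewrite inE => /eqP ->.
  by split=> [|j _]; [rewrite in_setT | apply: (center_min Iw wle)].
move=> a w1 w2 Iw1 Iw2 /(_ S0) /= [_ min1].
move=> /(_ S0) /= [_ min2] lt1 i _.
have a0 : a S0 = ord0.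
  by apply: (center_strict_min Iw1 lt1); apply: min1; rewrite in_setT.
by have := min2 i (in_setT i); rewrite a0.
Qed.

Lemma minimum_has_star : has_star (minimum_problem R) b.
Proof.
exists full_system, false, ord0, (leaves b).
split; [exact: full_system_nonempty | exact: center_notin_leaves
       | exact: card_leaves | exact: min_star].
Qed.

Lemma single_set_minimum_has_star : has_star (single_set_minimum_problem R) b.
Proof.
exists full_system, false, ord0, (leaves b).
split; [|exact: center_notin_leaves | exact: card_leaves | exact: min_star].
by split; [exact: full_system_nonempty | rewrite cards1].
Qed.

(** Pairs keep the leaves from being compared with each other; in one large set their mutual order
    would be required as well. *)
Definition pair_system : set_system :=
  @SetSystem b.+2 [set [set ord0; i] | i in leaves b].

Lemma pair_system_nonempty : nonempty_sets pair_system.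
Proof.
apply/imsetP => -[i _ /setP /(_ ord0)]; by rewrite !inE.
Qed.

Lemma sort_star : @star_input R (sorting_problem R) pair_system false ord0 (leaves b).
Proof.
split.
  exists (fun S : {set 'I_b.+2} => ord0 :: enum (S :\ ord0)) => w Iw wle S.
  case/imsetP => i iK ->.
  have i0 : i != ord0 by apply: contraTneq iK => ->; apply: center_notin_leaves.
  have -> : [set ord0; i] :\ ord0 = [set i].
    by apply/setP => j; rewrite !inE; case: eqVneq => // ->; rewrite eq_sym (negPf i0).
  rewrite enum_set1 /= andbT; split; last exact: (wle i iK).
  apply: uniq_perm; rewrite ?enum_uniq //= ?inE ?andbT 1?eq_sym //.
  by move=> j; rewrite mem_enum !inE.
move=> a w1 w2 Iw1 Iw2 C1 C2 lt1 i iK.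
have iF : [set ord0; i] \in Defs.family pair_system by apply: imset_f.
have [aperm sort1] := C1 _ iF; have [_ sort2] := C2 _ iF.
have i0 : i != ord0 by apply: contraTneq iK => ->; apply: center_notin_leaves.
have sz : size (a [set ord0; i]) = 2%N.
  by rewrite (perm_size aperm) -cardE cards2 eq_sym i0.
have ain j : (j \in a [set ord0; i]) = (j == ord0) || (j == i).
  by rewrite (perm_mem aperm) mem_enum !inE.
have au : uniq (a [set ord0; i]) by rewrite (perm_uniq aperm) enum_uniq.
move: (a _) sz ain au sort1 sort2 => [|j [|k [|? ?]]] //= _ ain.
rewrite !inE !andbT => jk le1 le2.
have jE : (j == ord0) || (j == i) by rewrite -ain mem_head.
have kE : (k == ord0) || (k == i) by rewrite -ain !inE eqxx orbT.
(* If the center comes first, sortedness under [w2] is the claim; if the leaf does, sortedness under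
   [w1] contradicts [lt1]. *)
have [j0|j0] := eqVneq j ord0.
  have k0 : k != ord0 by rewrite eq_sym -j0.
  by move: kE le2; rewrite (negPf k0) j0 => /eqP ->.
move: jE; rewrite (negPf j0) /= => /eqP jE; rewrite jE in jk le1.
move: kE; rewrite [k == i]eq_sym (negPf jk) orbF => /eqP kE.
by move: (lt1 i iK) le1; rewrite kE /= ltNge => /negPf ->.
Qed.

Lemma sorting_has_star : has_star (sorting_problem R) b.
Proof.
exists pair_system, false, ord0, (leaves b).
split; [exact: pair_system_nonempty | exact: center_notin_leaves
       | exact: card_leaves | exact: sort_star].
Qed.

End MinSortStar.

(** * Cycles and their spanning trees *)

Lemma eq_set2 (T : finType) (x y u v : T) :
  [set x; y] = [set u; v] -> (x = u /\ y = v) \/ (x = v /\ y = u).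
Proof.
move=> E.
have /set2P xE : x \in [set u; v] by rewrite -E set21.
have /set2P yE : y \in [set u; v] by rewrite -E set22.
have /set2P uE : u \in [set x; y] by rewrite E set21.
have /set2P vE : v \in [set x; y] by rewrite E set22.
by case: xE => xE; case: yE => yE; case: uE => uE; case: vE => vE;
  (left; split; congruence) || (right; split; congruence).
Qed.

Section Cycle.
Variable b : nat.
Hypothesis b_gt0 : (0 < b)%N.

Definition cycle_graph : graph :=
  @Graph b.+2 b.+2 (fun e => [set e; ordS e]).

Lemma ordS_val (i : 'I_b.+2) :
  ordS i = (if i == b.+1 :> nat then 0 else i.+1) :> nat.
Proof.
rewrite /=; case: eqP => [->|ib]; first by rewrite modnn.
by rewrite modn_small //; have := ltn_ord i; lia.
Qed.

Lemma ordS_neq (i : 'I_b.+2) : ordS i != i.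
Proof.
apply/eqP => /(congr1 (@nat_of_ord _)); rewrite ordS_val.
by have := ltn_ord i; case: eqP; lia.
Qed.

(** Here [b_gt0] enters: the cycle has at least three vertices, which keeps its edges from being
    parallel. *)
Lemma ordSS_neq (i : 'I_b.+2) : ordS (ordS i) != i.
Proof.
apply/eqP => /(congr1 (@nat_of_ord _)); rewrite ordS_val; have := ordS_val i.
by have := ltn_ord i; do 2!case: eqP; lia.
Qed.

Lemma cycle_adjP (T : {set 'I_b.+2}) (u v : 'I_b.+2) :
  reflect (exists2 e, e \in T & (u = e /\ v = ordS e) \/ (u = ordS e /\ v = e))
          (@adj cycle_graph T u v).
Proof.
apply: (iffP existsP) => [[e /andP[eT /eqP /eq_set2 E]]|[e eT E]]; exists e => //.
  by case: E => -[-> ->]; auto.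
by rewrite eT /=; case: E => -[-> ->] //; rewrite setUC.
Qed.

Lemma cycle_adj_sym (T : {set 'I_b.+2}) : symmetric (@adj cycle_graph T).
Proof. by move=> u v; apply: eq_existsb => e; rewrite setUC. Qed.

Lemma cycle_ends_inj : injective (@ends cycle_graph).
Proof.
move=> e f /eq_set2[[] //|[ef fe]].
by move: (ordSS_neq e); rewrite fe ef eqxx.
Qed.

(** Position of [v], counted from [ordS e], on the path left after cutting the cycle at edge [e]. *)
Definition dist_after (e v : 'I_b.+2) : nat :=
  if (e < v)%N then (v - e.+1)%N else (v + b.+2 - e.+1)%N.

Lemma dist_after_inj e : injective (dist_after e).
Proof.
move=> u v; rewrite /dist_after => E; apply: ord_inj.
have := ltn_ord u; have := ltn_ord v; have := ltn_ord e.
by move: E; case: (ltnP e u) => ?; case: (ltnP e v) => ?; lia.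
Qed.

Lemma dist_afterS e f : f != e -> dist_after e (ordS f) = (dist_after e f).+1.
Proof.
rewrite /dist_after ordS_val => /eqP fne.
have {}fne : f <> e :> nat by move=> /ord_inj.
have ltf := ltn_ord f; have lte := ltn_ord e.
by case: eqP => fb; case: (ltnP e f) => ?; case: ltnP => ?; lia.
Qed.

Lemma dist_after0 e v : dist_after e v = 0%N -> v = ordS e.
Proof.
rewrite /dist_after => E; apply: ord_inj; rewrite ordS_val.
have ltv := ltn_ord v; have lte := ltn_ord e.
by move: E; case: ltnP => ?; case: eqP => ?; lia.
Qed.

Lemma path_connected e : @spanning_connected cycle_graph (~: [set e]).
Proof.
have sym := sym_connect_sym (cycle_adj_sym (~: [set e])).
suff conn v : connect (@adj cycle_graph (~: [set e])) (ordS e) v.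
  by move=> u v; apply: connect_trans (conn v); rewrite sym.
have [m] := ubnP (dist_after e v); elim: m v => // m IHm v.
case E: (dist_after e v) => [|d] lt_d; first by rewrite (dist_after0 E).
have [ve|ve] := eqVneq v (ordS e); first by rewrite ve.
(* Edge [ord_pred v] leads one step back towards [ordS e]; it is the cut edge only if
   [v = ordS e]. *)
have fe : ord_pred v != e by apply: contraNneq ve => <-; rewrite ord_predK.
have := dist_afterS fe; rewrite ord_predK E => -[dE].
apply: (@connect_trans _ _ (ord_pred v)); first by apply: IHm; rewrite -dE; lia.
apply/connect1/cycle_adjP; exists (ord_pred v); first by rewrite !inE.
by left; rewrite ord_predK.
Qed.

Lemma adj_dist_after e u v : @adj cycle_graph (~: [set e]) u v ->
  dist_after e u = (dist_after e v).+1 \/ dist_after e v = (dist_after e u).+1.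
Proof.
case/cycle_adjP => f; rewrite !inE => fe.
by case=> -[-> ->]; rewrite dist_afterS //; auto.
Qed.

(* On a closed walk, both neighbours of a vertex farthest from [e] are its
   unique predecessor on the path. *)
Lemma path_acyclic e : @acyclic cycle_graph (~: [set e]).
Proof.
move=> c uc; rewrite ltnNge; apply/negP => c3.
have [x0 x0c] : exists x0, x0 \in c by case: c c3 {uc} => // x0 c _; exists x0; rewrite mem_head.
case: (@arg_maxnP _ x0 (mem c) (dist_after e) x0c) => v vc vmax.
have [i s rotE] := rot_to vc.
move: uc; rewrite -(rot_ucycle i) rotE => /andP[cyc un].
have sz : (3 <= (size s).+1)%N by rewrite -[(size s).+1]/(size (v :: s)) -rotE size_rot.
have smax u : u \in s -> (dist_after e u <= dist_after e v)%N.
  move=> us; apply: vmax; have : u \in rot i c by rewrite rotE inE us orbT.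
  by rewrite mem_rot.
case: s {rotE} sz smax cyc un => [|y s] // sz smax /=.
rewrite rcons_path => /andP[vy /andP[_ lv]] /and3P[_ ys _].
have yd : dist_after e v = (dist_after e y).+1.
  by case: (adj_dist_after vy) => // E; move: (smax y (mem_head _ _)); rewrite E ltnn.
have ld : dist_after e v = (dist_after e (last y s)).+1.
  by case: (adj_dist_after lv) => // E; move: (smax _ (mem_last _ _)); rewrite E ltnn.
(* The two neighbours of [v] on the walk coincide, which repeats a vertex because the walk has
   length at least three. *)
have ly : last y s = y by apply/(@dist_after_inj e)/succn_inj; rewrite -ld.
by case: s sz ys ly {smax lv ld} => // t s _ /negP ys /= ly; apply: ys; have := mem_last t s; rewrite ly.
Qed.

Lemma path_spanning_tree e : @spanning_tree cycle_graph (~: [set e]).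
Proof. by split; [exact: path_connected | exact: path_acyclic]. Qed.

(** The orbit of [ordS] is a closed walk without repetition, and it contains three distinct
    vertices. *)
Lemma cycle_not_acyclic : ~ @acyclic cycle_graph setT.
Proof.
move=> /(_ (orbit (@ordS b.+2) ord0)).
suff : (3 <= order (@ordS b.+2) ord0)%N.
  rewrite size_orbit leqNgt => /negP H; move/(_ _)/H; apply.
  rewrite /ucycle orbit_uniq andbT; apply: sub_cycle (cycle_orbit (@ordS_inj _) _).
  by move=> u v /eqP <-; apply/cycle_adjP; exists u; rewrite ?inE; auto.
set x := ord0; rewrite -(_ : #|[set x; ordS x; ordS (ordS x)]| = 3%N).
  apply/subset_leq_card/subsetP => y; rewrite !inE => /orP[/orP[]|] /eqP ->.
  - exact: (fconnect_iter _ 0).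
  - exact: (fconnect_iter _ 1).
  exact: (fconnect_iter _ 2).
rewrite setUC cardsU1 cards2 !inE (negPf (ordSS_neq x)) (inj_eq (@ordS_inj _)).
by rewrite [x == _]eq_sym (negPf (ordS_neq x)).
Qed.

Lemma cycle_simple_connected : simple_connected cycle_graph.
Proof.
split; first exact: cycle_ends_inj.
  by move=> e; rewrite cards2 eq_sym ordS_neq.
move=> u v; apply: connect_sub (path_connected ord0 u v) => {}u {}v uv.
case/cycle_adjP: uv => f _ E; apply/connect1/cycle_adjP.
by exists f; rewrite ?inE.
Qed.

Section Weights.
Variables (R : realType) (w : 'I_b.+2 -> R).
Hypothesis w_le0 : forall e, w e <= 0.

(** With nonpositive weights, omitting further edges only raises the total, so a tree is compared
    with a path without counting its edges. *)
Lemma sum_le_delete (T : {set 'I_b.+2}) e : e \notin T ->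
  \sum_f w f - w e <= \sum_(f in T) w f.
Proof.
move=> eT; rewrite (bigD1 e) //= addrAC subrr add0r [leLHS](bigID (mem T)) /=.
rewrite (eq_bigl (mem T)) => [|f]; last first.
  by case: eqVneq => //= ->; apply/esym/negbTE.
by rewrite gerDl sumr_le0.
Qed.

Lemma sum_delete e : \sum_(f in ~: [set e]) w f = \sum_f w f - w e.
Proof.
by rewrite [in RHS](bigD1 e) //= addrAC subrr add0r; apply: eq_bigl => f; rewrite !inE.
Qed.

Lemma min_spanning_tree_delete e : (forall f, w f <= w e) ->
  @min_spanning_tree cycle_graph R w (~: [set e]).
Proof.
move=> wmax; split; first exact: path_spanning_tree.
move=> T [_ acT]; have /subsetPn[f _ fT] : ~~ ([set: 'I_b.+2] \subset T).
  by apply/negP; rewrite subTset => /eqP TE; apply: cycle_not_acyclic; rewrite -TE.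
by apply: le_trans (sum_le_delete fT); rewrite sum_delete lerB.
Qed.

(** Compare [T] with the path that omits [f] instead. *)
Lemma min_spanning_tree_missing (T : {set 'I_b.+2}) e :
  @min_spanning_tree cycle_graph R w T -> e \notin T -> forall f, w f <= w e.
Proof.
move=> [_ minT] eT f; have := minT _ (path_spanning_tree f).
rewrite sum_delete => /(le_trans (sum_le_delete eT)).
by rewrite lerD2l lerN2.
Qed.

End Weights.

Lemma mst_has_star (R : realType) : has_star (mst_problem R) b.
Proof.
exists cycle_graph, true, ord0, (leaves b).
split; [exact: cycle_simple_connected | exact: center_notin_leaves
       | exact: card_leaves |].
have w_le0 (w : 'I_b.+2 -> R) : in_star true ord0 (leaves b) w -> forall e, w e <= 0.
  move=> /(in_starP _ _ (center_notin_leaves b))[/andP[Iz _] IK Io] e.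
  rewrite -oppr_ge0; have [->|ez] := eqVneq e ord0; first exact: ltW.
  have [/IK/andP[/= Ie _]|eK] := boolP (e \in leaves b); first by lra.
  by have /= -> := Io e ez eK; lra.
split.
  exists (~: [set ord0]) => w Iw wle.
  apply: min_spanning_tree_delete; first exact: w_le0.
  by move=> f; have /= := center_min Iw wle f; rewrite lerN2.
move=> T w1 w2 Iw1 Iw2 C1 C2 lt1 i _.
(* The answer [T] omits some edge. Under [w1] the center is the only heaviest edge, so it is the
   omitted one, and then [w2] must make it heaviest too. *)
have /subsetPn[e _ eT] : ~~ ([set: 'I_b.+2] \subset T).
  apply/negP; rewrite subTset => /eqP TE; apply: cycle_not_acyclic.
  by have [[_ acT] _] := C1; rewrite -TE.
have e0 : e = ord0.
  apply: (center_strict_min Iw1 lt1) => /=.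
  by rewrite lerN2; apply: (min_spanning_tree_missing (w_le0 _ Iw1) C1 eT).
rewrite /= lerN2 -e0.
exact: (min_spanning_tree_missing (w_le0 _ Iw2) C2 eT).
Qed.

End Cycle.

Theorem theorem1 (R : realType) (P : problem R)
  (hP : [\/ P = minimum_problem R, P = single_set_minimum_problem R,
            P = sorting_problem R | P = mst_problem R]) :
  (forall b : nat, (2 <= b)%N ->
     forall alpha : R, alpha < 1 + 1 / b%:R ->
       ~ exists A : algorithm P, robust b%:R A /\ consistent alpha A) /\
  (forall alpha : R, 1 < alpha ->
     forall beta : R, beta < Num.max (1 / (alpha - 1)) 2 ->
       ~ exists A : algorithm P, consistent alpha A /\ robust beta A).
Proof.
have starP b : (0 < b)%N -> has_star P b.
  move=> b0; case: hP => ->; [exact: minimum_has_star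
    | exact: single_set_minimum_has_star | exact: sorting_has_star
    | exact: mst_has_star].
split=> [b b2 alpha lta [A [robA conA]]|alpha alpha1 beta ltb [A [conA robA]]].
  by apply: (robust_not_consistent starP _ lta robA conA); apply: ltnW.
move: ltb; rewrite lt_max !ltNge (robust_ge2 starP robA).
by rewrite (consistent_robust_ge_inv starP alpha1 conA robA).
Qed.
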